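(* Let $X$ be a locally compact, separable, metrizable space whose quasi-component space $Q(X)$ is compact. Equip $X$ with the Freudenthal coarse proximity structure $(X,\mathcal{B}_C,\mathbf{b}_F)$. Then $\mathcal{U}X$, which is homeomorphic to the Freudenthal boundary $FX\setminus X$, is completely traceable in the Freudenthal compactification $FX$ of $X$.
   Context: Quasi-components. The quasi-component of a point $x\in X$ is the intersection of all clopen subsets of $X$ containing $x$. The quasi-component space $Q(X)$ is the set of quasi-components of $X$ with the topology generated by the clopen subsets of $X$. Proximities and Smirnov compactifications. A proximity on $X$ is a relation $\delta$ on the power set of $X$ that is symmetric; satisfies $A\delta B\Rightarrow A,B\ne\emptyset$; $A\cap B\neq\emptyset\Rightarrow A\delta B$; $A\delta(B\cup C)\iff A\delta B$ or $A\delta C$; and if $A\bar\delta B$ (negation) then there is $E\subseteq X$ with $A\bar\delta E$ and $(X\setminus E)\bar\delta B$. It is separated if $\{x\}\delta\{y\}\iff x=y$. A cluster of a separated proximity space $(X,\delta)$ is a collection $\sigma$ of nonempty subsets of $X$ such that $A\delta B$ for all $A,B\in\sigma$; if $C\delta A$ for all $A\in\sigma$ then $C\in\sigma$; and if $A\cup B\in\sigma$ then $A\in\sigma$ or $B\in\sigma$. The Smirnov compactification of $(X,\delta)$ is the set $\mathfrak{X}$ of all clusters with the separated proximity $\delta^*$: $\mathcal{A}\delta^*\mathcal{C}$ iff $A\delta C$ for all $A,C\subseteq X$ such that $A\in\sigma$ for every $\sigma\in\mathcal{A}$ and $C\in\sigma$ for every $\sigma\in\mathcal{C}$. Its topology (closure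 of $\mathcal{A}$ is $\{\sigma:\{\sigma\}\delta^*\mathcal{A}\}$) is compact Hausdorff, and $X$ is identified with the dense set of point clusters (those containing a singleton); then $cl_{\mathfrak{X}}(A)=\{\sigma\in\mathfrak{X}:A\in\sigma\}$ for $A\subseteq X$. Freudenthal structures. For a locally compact Hausdorff space $X$, the Freudenthal proximity $\delta_F$ is: $A\bar\delta_FB$ iff there is a compact $K\subseteq X$ disjoint from $A$ and $B$ such that $X\setminus K$ is the union of two disjoint open sets $U_1\supseteq A$ and $U_2\supseteq B$. It is a separated proximity; its Smirnov compactification is the Freudenthal compactification $FX$, and $FX\setminus X$ is the Freudenthal boundary. The Freudenthal coarse proximity structure is $(X,\mathcal{B}_C,\mathbf{b}_F)$ with $\mathcal{B}_C$ the collection of subsets of $X$ with compact closure (the bounded sets; other subsets are unbounded), and $A\mathbf{b}_FB\iff(A\setminus D)\delta_F(B\setminus D)$ for all $D\in\mathcal{B}_C$. Boundary and traceability. For the coarse proximity space $(X,\mathcal{B}_C,\mathbf{b}_F)$, let $\delta$ be its discrete extension, the separated proximity $A\delta B\iff(A\cap B\neq\emptyset$ or $A\mathbf{b}_FB)$, and let $\mathfrak{X}$ be the Smirnov compactification of $(X,\delta)$. The boundary $\mathcal{U}X\subseteq\mathfrak{X}$ is the subspace of clusters containing no bounded set; the trace of $A\subseteq X$ is $A'=cl_{\mathfrak{X}}(A)\cap\mathcal{U}X$. Under the identification of $\mathcal{U}X$ with $FX\setminus X$, $A'$ corresponds to $cl_{FX}(A)\cap(FX\setminus X)$. A closed set $C\subseteq\mathcal{U}X$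 is traceable if $A'=C$ for some unbounded $A\subseteq X$; $\mathcal{U}X$ is completely traceable if every nonempty closed $C\subseteq\mathcal{U}X$ is traceable.
   Formalization: The Freudenthal proximity is defined by compact separation of the closures of A and B; with the stated formula, without closures, it is not a proximity (on the real line the two open half-lines would be far, yet {0} is near both). The relation b_F is the same either way. *)

(* Defs.v *)
From HB Require Import structures.
From mathcomp Require Import all_boot all_order all_algebra.
From mathcomp Require Import all_classical all_reals topology.

Set Implicit Arguments.
Unset Strict Implicit.
Unset Printing Implicit Defensive.

Import Order.TTheory GRing.Theory Num.Theory.
Local Open Scope classical_set_scope.

Section General_topology.
Implicit Types S T : topologicalType.

Definition homeomorphism S T (f : S -> T) : Prop :=
  continuous f /\
  exists g : T -> S, [/\ continuous g, cancel f g & cancel g f].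

Definition metrizable (R : realType) T : Prop :=
  exists (M : metricType R) (f : T -> M), homeomorphism f.

Definition separable T : Prop := exists2 D : set T, countable D & dense D.

Lemma metrizable_hausdorff (R : realType) T :
  metrizable R T -> hausdorff_space T.
Proof.
move=> [M [f [cf [g [_ fK _]]]]] x y xy.
rewrite -[x]fK -[y]fK; congr g; apply: (@metric_hausdorff R M) => A B fA fB.
have [z [Az Bz]] := xy _ _ (cf x _ fA) (cf y _ fB).
by exists (f z).
Qed.

End General_topology.

Section Quasi_components.
Variable X : topologicalType.

Definition quasi_component (x : X) : set X :=
  \bigcap_(U in [set U | clopen U /\ U x]) U.

Definition quasi_components : Type := set_type (range quasi_component).

HB.instance Definition _ := Choice.copy quasi_components
  (set_type (range quasi_component)).

(* A clopen subset U of X is a union of quasi-components; it generates the   *)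
(* set of those that it contains.                                            *)
HB.instance Definition _ := isSubBaseTopological.Build quasi_components
  (@clopen X) (fun U => [set q : quasi_components | set_val q `<=` U]).

End Quasi_components.

Section Proximities.
Variable X : Type.
Implicit Types (A B C E : set X) (delta : set X -> set X -> Prop).

Record is_proximity delta : Prop := IsProximity {
  prox_sym : forall A B, delta A B -> delta B A ;
  prox_neq0 : forall A B, delta A B -> A !=set0 /\ B !=set0 ;
  prox_meet : forall A B, A `&` B !=set0 -> delta A B ;
  prox_setU : forall A B C, delta A (B `|` C) <-> delta A B \/ delta A C ;
  prox_split : forall A B, ~ delta A B ->
    exists E, ~ delta A E /\ ~ delta (~` E) B }.

Definition separated_prox delta : Prop :=
  forall x y, delta [set x] [set y] <-> x = y.

Record sproximity := SProximity {
  prox :> set X -> set X -> Prop ;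
  prox_is_proximity : is_proximity prox ;
  prox_separated : separated_prox prox }.

Record is_cluster delta (sigma : set (set X)) : Prop := IsCluster {
  cluster_neq0 : forall A, sigma A -> A !=set0 ;
  cluster_near : forall A B, sigma A -> sigma B -> delta A B ;
  cluster_max : forall C, (forall A, sigma A -> delta C A) -> sigma C ;
  cluster_setU : forall A B, sigma (A `|` B) -> sigma A \/ sigma B }.

Definition discrete_extension (b : set X -> set X -> Prop) A B : Prop :=
  A `&` B !=set0 \/ b A B.

Lemma proxS (p : sproximity) A B C : B `<=` C -> p A B -> p A C.
Proof.
move=> BC pAB; have <- : B `|` C = C by exact/setUidPr.
by apply/(prox_setU (prox_is_proximity p)); left.
Qed.

Lemma prox_symE (p : sproximity) A B : p A B <-> p B A.
Proof. by split; exact: prox_sym (prox_is_proximity p) _ _. Qed.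

End Proximities.

Section Smirnov.
Variables (X : Type) (p : sproximity X).

Definition smirnov : Type := set_type [set sigma | is_cluster p sigma].

HB.instance Definition _ :=
  Choice.copy smirnov (set_type [set sigma | is_cluster p sigma]).

Implicit Types (A B C : set X) (s : smirnov) (F G : set smirnov).

Definition smirnov_prox F G : Prop := forall A C,
  (forall s, F s -> set_val s A) -> (forall s, G s -> set_val s C) -> p A C.

Lemma smirnovP s : is_cluster p (set_val s).
Proof. exact: set_valP s. Qed.

Lemma smirnovS s A B : A `<=` B -> set_val s A -> set_val s B.
Proof.
move=> AB sA; apply: (cluster_max (smirnovP s)) => C sC.
by apply/prox_symE; apply: (proxS AB); exact: cluster_near (smirnovP s) _ _ sC sA.
Qed.

Lemma smirnov_notin s C : ~ set_val s C -> exists2 A, set_val s A & ~ p A C.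
Proof.
move=> nsC; apply: contrapT => h; apply: nsC.
apply: (cluster_max (smirnovP s)) => A sA; apply: contrapT => npCA.
by apply: h; exists A => //; rewrite prox_symE.
Qed.

Lemma smirnov_prox1 s G : smirnov_prox [set s] G <->
  forall C, (forall t, G t -> set_val t C) -> set_val s C.
Proof.
split=> [h C GC|h A C sA GC]; last first.
  by apply: (cluster_near (smirnovP s)); [exact: sA|exact: h].
apply: contrapT => /smirnov_notin[A sA]; apply.
by apply: h => // _ ->.
Qed.

(* Hence closure F = [set s | smirnov_prox [set s] F], see smirnov_closureE. *)
Definition smirnov_open F : Prop :=
  forall s, F s -> ~ smirnov_prox [set s] (~` F).

Let smirnov_openT : smirnov_open setT.
Proof.
move=> s _ /smirnov_prox1 h.
have /(cluster_neq0 (smirnovP s))[//] : set_val s set0 by apply: h => t [].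
Qed.

Let smirnov_openI : setI_closed smirnov_open.
Proof.
move=> F G oF oG s [Fs Gs] /smirnov_prox1 h.
have [C FC nsC] : exists2 C, (forall t, (~` F) t -> set_val t C) & ~ set_val s C.
  apply: contrapT => n; apply: (oF _ Fs); apply/smirnov_prox1 => C FC.
  by apply: contrapT => nsC; apply: n; exists C.
have [D GD nsD] : exists2 C, (forall t, (~` G) t -> set_val t C) & ~ set_val s C.
  apply: contrapT => n; apply: (oG _ Gs); apply/smirnov_prox1 => D GD.
  by apply: contrapT => nsD; apply: n; exists D.
have /(cluster_setU (smirnovP s))[//|//] : set_val s (C `|` D).
apply: h => t; rewrite setCI => -[/FC|/GD]; apply: smirnovS.
  exact: subsetUl.
exact: subsetUr.
Qed.

Let smirnov_open_bigU (I : Type) (F : I -> set smirnov) :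
  (forall i, smirnov_open (F i)) -> smirnov_open (\bigcup_i F i).
Proof.
move=> oF s [i _ Fis] /smirnov_prox1 h; apply: (oF i _ Fis).
apply/smirnov_prox1 => C FC; apply: h => t nFt; apply: FC => Fit.
by apply: nFt; exists i.
Qed.

HB.instance Definition _ := isOpenTopological.Build smirnov
  smirnov_openT smirnov_openI smirnov_open_bigU.

(* A as a subset of the compactification: the point clusters of its points   *)
Definition points A : set smirnov :=
  [set s | exists2 x, A x & set_val s [set x]].

Definition remainder : set smirnov := ~` points [set: X].

Lemma smirnov_closureE F : closure F = [set s | smirnov_prox [set s] F].
Proof.
have opE (G : set smirnov) : open G = smirnov_open G by [].
apply/seteqP; split=> s; last first.
  move=> /smirnov_prox1 h B; rewrite nbhsE => -[U [+ Us] UB].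
  rewrite opE => /(_ _ Us) n; apply: contrapT => FB; apply: n.
  apply/smirnov_prox1 => C UC; apply: h => t Ft; apply: UC => Ut.
  by apply: FB; exists t; split => //; exact: UB.
move=> clFs; apply: contrapT => ns.
suff oF : open (~` [set s | smirnov_prox [set s] F]).
  have /clFs[t [Ft]] : nbhs s (~` [set s | smirnov_prox [set s] F]).
    exact: open_nbhs_nbhs.
  by apply; apply/smirnov_prox1 => C; exact.
rewrite opE => t /= nt; rewrite setCK => /smirnov_prox1 h; apply: nt.
apply/smirnov_prox1 => C FC; apply: contrapT => /smirnov_notin[A tA npAC].
have [E [npAE npEC]] := prox_split (prox_is_proximity p) npAC.
apply: npAE; apply: (cluster_near (smirnovP t) tA); apply: h => u /smirnov_prox1.
move=> /(_ _ FC) uC.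
have : set_val u (E `|` ~` E).
  by apply: smirnovS uC => x _; rewrite setUv.
move=> /(cluster_setU (smirnovP u))[//|uE]; exfalso; apply: npEC.
exact: cluster_near (smirnovP u) _ _ uE uC.
Qed.

Lemma point_is_cluster x : is_cluster p [set A | p [set x] A].
Proof.
have pp := prox_is_proximity p; split=> [A /(prox_neq0 pp)[]//|A B xA xB|C h|].
- apply: contrapT => /(prox_split pp)[E [AE EB]].
  have [Ex|Ex] := pselect (E x).
    by apply: AE; apply: (@proxS _ p _ [set x]) => [_ ->//|]; apply/prox_symE.
  apply: EB; apply/prox_symE; apply: (@proxS _ p _ [set x]) => [_ ->//|].
  exact/prox_symE.
- by apply/prox_symE; apply: h; apply: (prox_meet pp); exists x.
- by move=> A B /(prox_setU pp).
Qed.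

Definition point_cluster (x : X) : smirnov :=
  SigSub (mem_set (point_is_cluster x)).

Lemma point_clusterP x A : set_val (point_cluster x) A <-> p [set x] A.
Proof. by []. Qed.

Lemma closure_points A : closure (points A) = [set s | set_val s A].
Proof.
have pp := prox_is_proximity p.
rewrite smirnov_closureE; apply/seteqP; split=> s /= => [/smirnov_prox1|sA].
  by apply=> t [x Ax]; apply: smirnovS => _ ->.
apply/smirnov_prox1 => C h; apply: contrapT => /smirnov_notin[B sB].
move=> /(prox_split pp)[E [npBE npEC]].
have [x [Ax Ex]] : A `&` ~` E !=set0.
  apply: contrapT => AE; apply: npBE.
  apply: (@proxS _ p _ A); last exact: (cluster_near (smirnovP s) sB sA).
  by move=> x Ax; apply: contrapT => Ex; apply: AE; exists x.
have /h/point_clusterP xC : points A (point_cluster x).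
  by exists x => //; apply/point_clusterP/(prox_meet pp); exists x.
by apply: npEC; apply/prox_symE/(@proxS _ p _ [set x])/prox_symE => // _ ->.
Qed.

End Smirnov.
Arguments points [X] p A _.
Arguments remainder [X] p _.

Section Boundary.
Variables (X : Type) (p : sproximity X) (bounded : set (set X)).

Definition boundary : set (smirnov p) :=
  [set s | forall B, bounded B -> ~ set_val s B].

Definition trace (A : set X) : set (smirnov p) :=
  closure (points p A) `&` boundary.

Definition traceable (C : set boundary) : Prop :=
  exists A : set X, ~ bounded A /\ trace A = set_val @` C.

Definition completely_traceable : Prop :=
  forall C : set boundary, closed C -> C !=set0 -> traceable C.

End Boundary.
Arguments boundary [X] p bounded _.
Arguments trace [X] p bounded A _.
Arguments traceable [X] p bounded C.
Arguments completely_traceable [X] p bounded.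

Section Freudenthal.
Variable X : topologicalType.
Implicit Types A B C D K U : set X.

Definition compactly_separated A B : Prop :=
  exists K U1 U2, [/\ compact K, K `&` A = set0 & K `&` B = set0] /\
    [/\ open U1, open U2, U1 `&` U2 = set0, ~` K = U1 `|` U2 &
        A `<=` U1 /\ B `<=` U2].

(* The separation is between closures: with compactly_separated A B, the     *)
(* half-lines A = ]0, +oo[ and B = ]-oo, 0[ of the real line would be far    *)
(* from each other (K = [set 0]) but both near [set 0], which is impossible  *)
(* in a proximity. Both give the same freudenthal_coarse, see               *)
(* freudenthal_coarse_noclosure.                                             *)
Definition freudenthal_prox A B : Prop :=
  ~ compactly_separated (closure A) (closure B).

Definition relatively_compact A : Prop := compact (closure A).

Definition freudenthal_coarse A B : Prop :=
  forall D, relatively_compact D -> freudenthal_prox (A `\` D) (B `\` D).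

Hypotheses (lcX : locally_compact [set: X]) (hX : hausdorff_space X).

Lemma compactly_separated_sym A B :
  compactly_separated A B -> compactly_separated B A.
Proof.
move=> [K [U1 [U2 [[cK KA KB] [o1 o2 U12 KU [AU BU]]]]]].
by exists K, U2, U1; split; split => //; rewrite 1?setIC 1?setUC.
Qed.

Lemma compactly_separatedS A B A' B' : A `<=` A' -> B `<=` B' ->
  compactly_separated A' B' -> compactly_separated A B.
Proof.
move=> AA BB [K [U1 [U2 [[cK KA KB] [o1 o2 U12 KU [AU BU]]]]]].
exists K, U1, U2; split; split => //.
- by apply: subsetI_eq0 KA.
- by apply: subsetI_eq0 KB.
- by split; apply: subset_trans; eauto.
Qed.

Let good (F N : set X) := [/\ compact N, closed N & N `&` F = set0].

Let goodU (F N M : set X) : good F N -> good F M -> good F (N `|` M).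
Proof.
move=> [cN oN NF] [cM oM MF]; split; first exact: compactU.
  exact: closedU.
by rewrite setIUl NF MF setU0.
Qed.

Lemma compact_shield K (F : set X) : compact K -> closed F -> K `&` F = set0 ->
  exists N, [/\ compact N, closed N, N `&` F = set0 & K `<=` N°].
Proof.
move=> cK cF KF; pose G := filter_from (good F)
  (fun N => [set M | good F M /\ N `<=` M]).
have FG : Filter G.
  apply: filter_from_filter.
    exists set0; split; [exact: compact0|exact: closed0|exact: set0I].
  move=> N M gN gM; exists (N `|` M); first exact: goodU.
  by move=> L [gL NML]; split; split => // x ?; apply: NML; [left|right].
have KG x : K x -> \forall x' \near x & M \near G, M° x'.
  move=> Kx; have [V] := @lcX x I.
  move=> VTx [cV clV]; have Vx : nbhs x V.
    rewrite /within /prop_near1 in VTx.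
    exact: (filterS (fun y (h : [set: X] y -> V y) => h I) VTx).
  have : nbhs x (~` F).
    apply: open_nbhs_nbhs; split; first exact: closed_openC.
    by move=> Fx; rewrite -[False]/(set0 x) -KF.
  move=> /(compact_regular hX cV Vx)[W Wx WF].
  have gVW : good F (V `&` closure W).
    have clVW : closed (V `&` closure W).
      by apply: closedI => //; exact: closed_closure.
    split => //; first by apply: subclosed_compact clVW cV _; exact: subIsetl.
    by apply/seteqP; split=> // y [[_ /WF]].
  exists ((V `&` closure W)°, [set M | good F M /\ V `&` closure W `<=` M]).
    split => /=; last by exists (V `&` closure W).
    apply: nbhs_interior; apply: filterI => //.
    by apply: filterS Wx; exact: subset_closure.
  by move=> [y M] /= [Vy [_ /interiorS VM]]; exact: VM.
have /compact_near_coveringP/(_ _ G (fun M x => M° x) FG KG) := cK.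
move=> [N [cN clN NF] /(_ N)/= KN]; exists N; split => //.
by apply: KN; split.
Qed.

Lemma closed_compactly_sep K (U1 U2 : set X) :
  open U1 -> open U2 -> U1 `&` U2 = set0 -> ~` K = U1 `|` U2 ->
  closure U1 `<=` U1 `|` K.
Proof.
move=> o1 o2 U12 KU x clx; have [Kx|/[!KU] -[U1x|U2x]] : K x \/ (~` K) x.
- exact: EM.
- by right.
- by left.
- have [y [U1y U2y]] := clx _ (open_nbhs_nbhs (conj o2 U2x)).
  by have : (U1 `&` U2) y by []; rewrite U12.
Qed.

Lemma freudenthal_is_proximity : is_proximity freudenthal_prox.
Proof.
split.
- by move=> A B AB /compactly_separated_sym.
- have sep0 A : compactly_separated set0 A.
    exists set0, set0, setT; split; split.
    + exact: compact0.
    + exact: set0I.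
    + exact: set0I.
    + exact: open0.
    + exact: openT.
    + exact: set0I.
    + by rewrite setC0 set0U.
    + by split.
  move=> A B AB; split; apply/set0P/eqP => E0; apply: AB; rewrite E0 closure0.
    exact: sep0.
  exact/compactly_separated_sym/sep0.
- move=> A B [x [Ax Bx]] [K [U1 [U2 [_ [_ _ U12 _ [AU BU]]]]]].
  rewrite -[False]/(set0 x) -U12; split; [apply: AU|apply: BU];
    exact: subset_closure.
- move=> A B C; split; last first.
    rewrite /freudenthal_prox closureU => -[] h; apply: contra_not h.
      by apply: compactly_separatedS => //; exact: subsetUl.
    by apply: compactly_separatedS => //; exact: subsetUr.
  move=> ABC; apply: contrapT => /not_orP[/contrapT AB /contrapT AC]; apply: ABC.
  rewrite closureU; move: AB AC; move: (closure A) (closure B) (closure C).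
  move=> {}A {}B {}C [K [U1 [U2 [[cK KA KB] [o1 o2 U12 KU [AU BU]]]]]].
  move=> [L [V1 [V2 [[cL LA LC] [p1 p2 V12 LV [AV CV]]]]]].
  pose W1 := U1 `&` V1; pose W2 := U2 `|` V2.
  have oW1 : open W1 by exact: openI.
  have oW2 : open W2 by exact: openU.
  exists (~` (W1 `|` W2)), W1, W2; rewrite setCK.
  have W12 : W1 `&` W2 = set0.
    apply/seteqP; split => // x [[U1x V1x] [U2x|V2x]].
      by rewrite -U12.
    by rewrite -V12.
  have AW : A `<=` W1 by move=> x Ax; split; [exact: AU|exact: AV].
  have BW : B `|` C `<=` W2 by move=> x [/BU|/CV]; [left|right].
  split; split => //.
  + apply: (subclosed_compact _ (compactU cK cL)).
      by apply: open_closedC; exact: openU.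
    move=> x /not_orP[/not_andP nW1 /not_orP[nU2 nV2]].
    have [Kx|/[!KU] -[U1x|//]] : K x \/ (~` K) x by exact: EM.
      by left.
    have [Lx|/[!LV] -[V1x|//]] : L x \/ (~` L) x by exact: EM.
      by right.
    by case: nW1.
  + by apply/seteqP; split => // x [nW /AW ?]; case: nW; left.
  + by apply/seteqP; split => // x [nW /BW ?]; case: nW; right.
- move=> A B /contrapT[K [U1 [U2 [[cK KA KB] [o1 o2 U12 KU [AU BU]]]]]].
  have KAB : K `&` (closure A `|` closure B) = set0 by rewrite setIUr KA KB setU0.
  have clAB : closed (closure A `|` closure B) by apply: closedU; exact: closed_closure.
  have [N [cN clN NAB KN]] := compact_shield cK clAB KAB.
  have sepN (U V F G : set X) : open U -> open V -> U `&` V = set0 ->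
      ~` K = U `|` V -> F `<=` U -> F `&` N = set0 -> G `<=` V `|` K ->
      compactly_separated F G.
    move=> oU oV UV KUV FU FN GV.
    pose W1 := U `&` ~` N; pose W2 := V `|` N°.
    have oW1 : open W1 by apply: openI => //; exact: closed_openC.
    have oW2 : open W2 by apply: openU => //; exact: open_interior.
    exists (~` (W1 `|` W2)), W1, W2; rewrite setCK.
    have FW : F `<=` W1.
      move=> x Fx; split; first exact: FU.
      by move=> Nx; rewrite -[False]/(set0 x) -FN.
    have GW : G `<=` W2 by move=> x /GV[?|/KN]; [left|right].
    split; split => //.
    + apply: (subclosed_compact _ cN); first by apply: open_closedC; exact: openU.
      move=> x /not_orP[/not_andP nW1 /not_orP[nV nN]].
      apply: contrapT => nNx; case: nW1 => [nU|]; last by [].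
      have : (~` K) x by move=> /KN.
      by rewrite KUV => -[].
    + by apply/seteqP; split => // x [nW /FW ?]; case: nW; left.
    + by apply/seteqP; split => // x [nW /GW ?]; case: nW; right.
    + apply/seteqP; split => // x [[Ux nNx] [Vx|/interior_subset//]].
      by rewrite -UV.
  have U21 : U2 `&` U1 = set0 by rewrite setIC.
  have KU' : ~` K = U2 `|` U1 by rewrite setUC.
  have FN (F : set X) : F `<=` closure A `|` closure B -> F `&` N = set0.
    by move=> FAB; apply/seteqP; split => // x [/FAB ABx Nx]; rewrite -NAB.
  exists (U2 `|` K); split; apply.
    apply: (sepN U1 U2) => //; first by apply: FN; exact: subsetUl.
    rewrite closureU -(closure_id K).1; last exact: compact_closed.
    move=> x [/(closed_compactly_sep o2 o1 U21 KU')//|]; by right.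
  apply: compactly_separated_sym; apply: (sepN U2 U1) => //.
    by apply: FN; exact: subsetUr.
  have EU : ~` (U2 `|` K) `<=` U1.
    move=> x /not_orP[nU2 nK]; have : (~` K) x by [].
    by rewrite KU => -[].
  by apply: subset_trans (closureS EU) _; exact: closed_compactly_sep KU.
Qed.

Lemma freudenthal_separated : separated_prox freudenthal_prox.
Proof.
have cl1 (z : X) : closed [set z].
  by apply: compact_closed => //; exact: compact_set1.
move=> x y; split=> [|<-]; last first.
  by apply: (prox_meet freudenthal_is_proximity); exists x.
apply: contraPP => xy; apply.
rewrite -!(closure_id _).1 //.
have xy0 : [set x] `&` [set y] = set0 by apply/seteqP; split => // z [-> /xy].
have [N [cN clN Ny xN]] := compact_shield (@compact_set1 _ x) (cl1 y) xy0.
exists (N `&` ~` N°), N°, (~` N); split; split.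
- by apply: compact_closedI => //; exact/open_closedC/open_interior.
- by apply/seteqP; split => // z [[_ nNz] /xN].
- by apply/seteqP; split => // z [[Nz _] yz]; rewrite -Ny.
- exact: open_interior.
- exact: closed_openC.
- by apply/seteqP; split => // z [/interior_subset].
- by rewrite setCI setCK setUC.
- by split=> // z yz Nz; rewrite -[False]/(set0 z) -Ny.
Qed.

Definition freudenthal : sproximity X :=
  SProximity freudenthal_is_proximity freudenthal_separated.

Lemma relatively_compactU A B : relatively_compact A -> relatively_compact B ->
  relatively_compact (A `|` B).
Proof. by rewrite /relatively_compact closureU; exact: compactU. Qed.

Lemma relatively_compact0 : relatively_compact set0.
Proof. by rewrite /relatively_compact closure0; exact: compact0. Qed.

Lemma freudenthal_coarse_noclosure A B : freudenthal_coarse A B <->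
  forall D, relatively_compact D -> ~ compactly_separated (A `\` D) (B `\` D).
Proof.
split=> h D rD; last first.
  move=> cs; apply: (h _ rD).
  by apply: compactly_separatedS cs; exact: subset_closure.
move=> [K [U1 [U2 [[cK _ _] [o1 o2 U12 KU [AU BU]]]]]].
have [N [cN clN _ KN]] := compact_shield cK (@closed0 X) (setI0 K).
apply: (h (D `|` N)).
  by apply: relatively_compactU => //; rewrite /relatively_compact -(closure_id _).1.
have KF (F : set X) : K `&` closure (F `\` (D `|` N)) = set0.
  apply/seteqP; split => // x [/KN Nx /(_ _ Nx)[y [[_ nDNy] Ny]]].
  by apply: nDNy; right.
have FU (F U V : set X) : open U -> open V -> U `&` V = set0 ->
    ~` K = U `|` V -> F `\` D `<=` U -> closure (F `\` (D `|` N)) `<=` U.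
  move=> oU oV UV KUV FU x Fx.
  have : (U `|` K) x.
    apply: (closed_compactly_sep oU oV UV KUV); apply: closureS Fx => y [Fy DNy].
    by apply: FU; split => // Dy; apply: DNy; left.
  move=> [//|Kx]; have : (K `&` closure (F `\` (D `|` N))) x by [].
  by rewrite KF.
exists K, U1, U2; split; split => //; split.
  by apply: (FU A U1 U2).
by apply: (FU B U2 U1) => //; [rewrite setIC|rewrite setUC].
Qed.

Lemma freudenthal_coarse_sym A B :
  freudenthal_coarse A B -> freudenthal_coarse B A.
Proof.
by move=> AB D /AB; exact: (prox_sym freudenthal_is_proximity).
Qed.

Lemma freudenthal_coarse_far A B :
  ~ freudenthal_coarse A B ->
  exists2 D, relatively_compact D & ~ freudenthal_prox (A `\` D) (B `\` D).
Proof. by move=> /existsNP[D /not_implyP[? ?]]; exists D. Qed.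

Lemma freudenthal_discrete_is_proximity :
  is_proximity (discrete_extension freudenthal_coarse).
Proof.
have fP := freudenthal_is_proximity; pose f := freudenthal.
split.
- move=> A B [AB|AB]; first by left; rewrite setIC.
  by right; exact: freudenthal_coarse_sym.
- move=> A B [[x [Ax Bx]]|/(_ _ relatively_compact0)].
    by split; exists x.
  by move=> /(prox_neq0 fP); rewrite !setD0.
- by move=> A B AB; left.
- move=> A B C; split; last first.
    move=> [[[x [Ax Bx]]|AB]|[[x [Ax Cx]]|AC]].
    + by left; exists x; split => //; left.
    + right=> D /AB; apply: (@proxS _ f); apply: setSD; exact: subsetUl.
    + by left; exists x; split => //; right.
    + right=> D /AC; apply: (@proxS _ f); apply: setSD; exact: subsetUr.
  move=> [[x [Ax [Bx|Cx]]]|ABC].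
  + by left; left; exists x.
  + by right; left; exists x.
  apply: contrapT => /not_orP[/not_orP[_ AB] /not_orP[_ AC]].
  have [D rD ABD] := freudenthal_coarse_far AB.
  have [E rE ACE] := freudenthal_coarse_far AC.
  have := ABC _ (relatively_compactU rD rE); rewrite setDUl.
  have SD F : F `\` (D `|` E) `<=` F `\` D.
    by move=> x [Fx DE]; split => // Dx; apply: DE; left.
  have SE F : F `\` (D `|` E) `<=` F `\` E.
    by move=> x [Fx DE]; split => // Dx; apply: DE; right.
  move=> /(prox_setU fP)[h|h]; [apply: ABD|apply: ACE].
    apply: (@proxS _ f _ _ _ (SD B)); apply/(prox_symE f).
    by apply: (@proxS _ f _ _ _ (SD A)); apply/(prox_symE f).
  apply: (@proxS _ f _ _ _ (SE C)); apply/(prox_symE f).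
  by apply: (@proxS _ f _ _ _ (SE A)); apply/(prox_symE f).
- move=> A B /not_orP[/set0P/negP/negPn/eqP AB /freudenthal_coarse_far[D rD ABD]].
  have [E0 [AE0 E0B]] := prox_split fP ABD.
  exists ((E0 `|` B) `\` A); split => -[].
  + by move=> [x [Ax [_]]].
  + move=> /(_ _ rD) h; have : freudenthal_prox (A `\` D) (E0 `|` (B `\` D)).
      apply: (@proxS _ f) h => x [[[Ex|Bx] _] nDx]; first by left.
      by right.
    by move=> /(prox_setU fP)[].
  + move=> [x [nx Bx]]; apply: nx; split; first by right.
    by move=> Ax; rewrite -[False]/(set0 x) -AB.
  + move=> /(_ _ rD) /(prox_sym fP) h.
    have : freudenthal_prox (B `\` D) ((A `\` D) `|` ~` E0).
      apply: (@proxS _ f) h => x [nx nDx].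
      have [Ax|nAx] := pselect (A x); first by left.
      by right => Ex; apply: nx; split => //; left.
    by move=> /(prox_setU fP)[] /(prox_sym fP).
Qed.

Lemma freudenthal_discrete_separated :
  separated_prox (discrete_extension freudenthal_coarse).
Proof.
move=> x y; split=> [[[z [<- <-]]//|h]|<-]; last by left; exists x.
have rx : relatively_compact [set x].
  rewrite /relatively_compact -(closure_id _).1; first exact: compact_set1.
  by apply: compact_closed => //; exact: compact_set1.
have [[z []//]] := prox_neq0 freudenthal_is_proximity (h _ rx).
Qed.

Definition freudenthal_discrete : sproximity X :=
  SProximity freudenthal_discrete_is_proximity freudenthal_discrete_separated.

End Freudenthal.

(* Main.v *)
Require Import Defs.
From mathcomp Require Import all_boot all_order all_algebra.
From mathcomp Require Import all_classical all_reals topology.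

Set Implicit Arguments.
Unset Strict Implicit.
Unset Printing Implicit Defensive.

Import Order.TTheory GRing.Theory Num.Theory.
Local Open Scope classical_set_scope.

(** The boundary of X, first as a set of clusters. A cluster of the discrete
extension delta without bounded sets is stable under removing a bounded set
from its members, and for such families nearness in delta and nearness in the
Freudenthal proximity deltaF are the same condition
([freudenthal_coarse_setD]). Hence the two notions of cluster agree as
families of subsets of X ([unbounded_cluster_iff]). On the side of deltaF, by
compactness, a cluster containing a bounded set contains a point, so the
clusters without bounded sets are those of the remainder
([remainder_unbounded]). The homeomorphism is the identity on families; it is
bicontinuous because the sets of clusters avoiding a given subset of X form a
base of the topology on both sides ([same_clusters_continuous]), and it
preserves traces because s is in the closure of A if and only if A belongs
to s.

Complete traceability rests on a countability argument. Let O_n be an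
increasing sequence of relatively compact open sets absorbing every compact
set. Two sets are far in delta exactly when, up to some O_n, they are
contained in complementary relatively clopen parts of X \ O_n
([far_clopen_in], [clopen_in_far]); so the boundary is determined by the
clopen subsets of the sets X \ O_n, and the point is that there are only
countably many of them.

Compactness of Q(X) says that every cover of X by clopen sets has a finite
subcover. This passes from X to X \ O for O open and relatively compact
([clopen_compactC]): finitely many members of a cover of X \ O by relatively
clopen sets cover the compact frontier of O, and what remains is a clopen
subset of X. A space with this property and with a countable base has
countably many clopen sets ([countable_clopen_in]): choose a clopen set for
each pair of basic sets that a clopen set separates; every clopen set is a
finite union of finite intersections of the chosen ones.

Now let C be closed and nonempty in the boundary. Let w_0, w_1, ... enumerate
the relatively clopen sets belonging to all clusters of C, and e_0, e_1, ...
those belonging to some cluster of C. For i <= k pick a point x_ik of e_i, of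
w_0, ..., w_(k-1), and outside O_k, and let A be the set of the x_ik. Each
A \ w_j is finite, so the clusters of the trace of A contain all the w_j, and
are in C because C is closed. Each A `&` e_i is unbounded, so no cluster of C
contains a set far from A: C is contained in the trace of A. *)

(** * Countable families *)

Lemma countable_enum (T : Type) (A : set T) :
  countable A -> A !=set0 -> exists e : nat -> T, range e = A.
Proof.
move=> /pfcard_geP[->|[e]] [x Ax]; first by [].
exists e; apply/seteqP; split=> [_ [i _ <-]|y Ay]; first exact: funS.
by have [i _ <-] := (@surj _ _ _ _ e) y Ay; exists i.
Qed.

Lemma countable_setU (T : Type) (A B : set T) :
  countable A -> countable B -> countable (A `|` B).
Proof.
move=> cA cB; rewrite -bigcup2inE; apply: bigcup_countable => // i _.
by rewrite /bigcup2; case: ifP => // _; case: ifP.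
Qed.

Lemma countable_op_closure (T : Type) (op : T -> T -> T) (S : set T) :
  countable S -> exists S', [/\ countable S', S `<=` S' &
    forall a b, S' a -> S' b -> S' (op a b)].
Proof.
move=> cS.
pose step (A : set T) := A `|` (fun ab => op ab.1 ab.2) @` (A `*` A).
pose L n := iter n step S.
have cstep A : countable A -> countable (step A).
  move=> cA; apply: countable_setU => //.
  by apply: sub_countable (card_image_le _ _) _; exact: countableX.
have Lmono m n : (m <= n)%N -> L m `<=` L n.
  move=> /subnK <-; elim: (n - m)%N => // k IH.
  by apply: (subset_trans IH) => x; left.
exists (\bigcup_n L n); split.
- by apply: bigcup_countable => // n _; elim: n => //= n; exact: cstep.
- by move=> x Sx; exists 0%N.
- move=> a b [m _ La] [n _ Lb]; exists (maxn m n).+1 => //; right; exists (a, b) => //.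
  split; [exact: (Lmono m) (leq_maxl _ _) _ La|exact: (Lmono n) (leq_maxr _ _) _ Lb].
Qed.

(** * Covers by clopen sets *)

(** Covers directed by union replace finite subcovers throughout: then no
finite families have to be handled. *)
Lemma compact_ideal (T : topologicalType) (K : set T) (F : set (set T)) :
  compact K -> F set0 -> setU_closed F ->
  (forall x, K x -> exists2 U, F U & nbhs x U) -> exists2 U, F U & K `<=` U.
Proof.
move=> cK F0 FU FK.
pose G := filter_from F (fun U => [set V | F V /\ U `<=` V]).
have FG : Filter G.
  apply: filter_from_filter; first by exists set0.
  move=> U V FUU FV; exists (U `|` V); first exact: FU.
  by move=> W [FW UVW]; split; split=> // x ?; apply: UVW; [left|right].
have KG x : K x -> \forall x' \near x & M \near G, M x'.
  move=> /FK[U FUU Ux]; exists (U, [set M | F M /\ U `<=` M]).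
    by split => //=; exists U.
  by move=> [y M] /= [Uy [_]]; exact.
have /compact_near_coveringP/(_ _ G (fun M x => M x) FG KG) := cK.
by move=> [U FUU /(_ U)/= KU]; exists U => //; apply: KU; split.
Qed.

Section Clopen_compactness.
Variable X : topologicalType.
Implicit Types (O U V W Y : set X).

Definition clopen_in Y V := [/\ V `<=` Y, closed V & closed (Y `\` V)].

Lemma clopen_inC Y V : clopen_in Y V -> clopen_in Y (Y `\` V).
Proof.
move=> [VY cV cYV]; split; [exact: subDsetl|by []|].
by rewrite setDD (setIidr VY).
Qed.

Lemma clopen_inT Y : closed Y -> clopen_in Y Y.
Proof. by move=> cY; split=> //; rewrite setDv; exact: closed0. Qed.

Lemma clopen_in0 Y : closed Y -> clopen_in Y set0.
Proof. by move=> /clopen_inT/clopen_inC; rewrite setDv. Qed.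

Lemma clopen_inI Y U V : clopen_in Y U -> clopen_in Y V -> clopen_in Y (U `&` V).
Proof.
move=> [UY cU cYU] [VY cV cYV]; split; first by move=> x [/UY].
  exact: closedI.
by rewrite setDIr; exact: closedU.
Qed.

(** For Y closed this is the compactness of the quasi-component space of Y,
phrased without that space. *)
Definition clopen_compact Y := forall F : set (set X), F set0 -> setU_closed F ->
  (forall x, Y x -> exists U, [/\ F U, clopen_in Y U & U x]) ->
  exists2 U, F U & Y `<=` U.

Lemma quasi_components_clopen_compact :
  compact [set: quasi_components X] -> clopen_compact setT.
Proof.
move=> cQ F F0 FU FX.
pose inside U := [set q : quasi_components X | set_val q `<=` U].
have qcx x : range (@quasi_component X) (quasi_component x) by exists x.
have [|||O [U FUU OU] TO] :=
    @compact_ideal _ _ [set O | exists2 U, F U & O `<=` inside U] cQ.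
- by exists set0.
- move=> O1 O2 [U1 F1 OU1] [U2 F2 OU2]; exists (U1 `|` U2); first exact: FU.
  by move=> q [/OU1|/OU2] qU x /qU; [left|right].
- move=> q _; have [x _ qE] : range (@quasi_component X) (set_val q) by exact: set_valP.
  have [U [FUU [_ cU cCU] Ux]] := FX x I.
  have clU : clopen U.
    by split=> //; rewrite -[U]setCK; apply: closed_openC; rewrite -setTD.
  exists (inside U); first by exists U.
  apply: open_nbhs_nbhs; split.
    exists [set inside U]; last by rewrite bigcup_set1.
    by move=> _ ->; exact: (finI_from1 inside clU).
  by rewrite /inside /mkset -qE => y; apply.
exists U => // x _.
by apply: (OU (SigSub (mem_set (qcx x)))) => [|V [_]//]; exact: TO.
Qed.

(** Some member U of the directed cover contains the frontier of O, which is
compact; then (X \ O) \ U is disjoint from the closure of O, hence clopen in X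
itself, where the hypothesis on X applies. *)
Lemma clopen_compactC O : hausdorff_space X -> open O -> relatively_compact O ->
  clopen_compact setT -> clopen_compact (~` O).
Proof.
move=> hX oO rO cX F F0 FU FY; set Y := ~` O.
have cY : closed Y by exact: open_closedC.
pose F1 := [set M | exists U, [/\ F U, clopen_in Y U & M `<=` U `|` O]].
have [|||M [U [FUU [UY cU cYU] MU]] KM] := @compact_ideal _ (closure O) F1 rO.
- by exists set0; split => //; exact: clopen_in0.
- move=> M N [U [FUU kU MU]] [V [FV kV NV]]; exists (U `|` V); split.
  + exact: FU.
  + have := clopen_inI (clopen_inC kU) (clopen_inC kV).
    move=> /clopen_inC; rewrite setDIr !setDD.
    by case: kU kV => [/setIidr -> _ _] [/setIidr -> _ _].
  + by move=> x [/MU|/NV] []; [left; left|right|left; right|right].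
- move=> x _; have [Ox|Yx] := pselect (O x).
    exists O; last exact: open_nbhs_nbhs.
    by exists set0; split; [|exact: clopen_in0|right].
  have [U [FUU kU Ux]] := FY x Yx; exists (U `|` O); first by exists U; split.
  apply: open_nbhs_nbhs; split; last by left.
  by case: kU => _ _ /closed_openC; rewrite setCD setCK setUC.
have {MU}KU : closure O `<=` U `|` O by exact: subset_trans MU.
pose W := Y `\` U.
have oW : open W.
  have -> : W = ~` (U `|` closure O).
    rewrite setCU setIC; apply/seteqP; split=> x.
      by move=> [Ox nUx]; split=> // /KU[].
    by move=> [nOx nUx]; split=> // Ox; apply: nOx; exact: subset_closure.
  by apply: closed_openC; apply: closedU => //; exact: closed_closure.
have [|||M' [V FV MV] TM] := cX [set M | exists2 V, F V & M `&` W `<=` V].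
- by exists set0 => //; rewrite set0I.
- move=> A B [V1 F1' AV] [V2 F2 BV]; exists (V1 `|` V2); first exact: FU.
  by rewrite setIUl => x [/AV|/BV]; [left|right].
- move=> x _; have [Wx|nWx] := pselect (W x); last first.
    exists (~` W); split => //; first by exists set0 => //; rewrite setICl.
    split=> //; first exact: open_closedC.
    by rewrite setTD setCK.
  have [V [FV [VY cV cYV] Vx]] := FY x Wx.1.
  exists (V `&` W); split=> //; first by exists V => // y [[]].
  split=> //; first exact: closedI.
  rewrite setTD setCI.
  have -> : ~` V `|` ~` W = (Y `\` V) `|` ~` W.
    apply/seteqP; split=> y [nVy|nWy]; [|by right| |by right].
      have [Oy|Yy] := pselect (O y); last by left.
      by right => -[].
    by left; case: nVy.
  by apply: closedU => //; exact: open_closedC.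
exists (U `|` V); first exact: FU.
move=> x Yx; have [Ux|nUx] := pselect (U x); first by left.
by right; apply: MV; split=> //; exact: TM.
Qed.

(** A Stone-Weierstrass argument for clopen sets: a family of clopen sets that
separates the points which clopen sets can separate generates all clopen sets
under finite unions and intersections. A countable base provides a countable
separating family. *)
Lemma countable_clopen_in Y : second_countable (T := X) -> closed Y ->
  clopen_compact Y -> countable (clopen_in Y).
Proof.
move=> [B cB [oB bB]] cY kY.
have /choice[sep sepP] : forall P : set X * set X, exists S, clopen_in Y S /\
    forall U, clopen_in Y U -> P.1 `&` Y `<=` U -> P.2 `&` U = set0 ->
      P.1 `&` Y `<=` S /\ P.2 `&` S = set0.
  move=> P; have [[U [kU PU UP]]|nU] := pselect (exists U,
      [/\ clopen_in Y U, P.1 `&` Y `<=` U & P.2 `&` U = set0]).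
    by exists U.
  exists Y; split; first exact: clopen_inT.
  by move=> U kU PU UP; case: nU; exists U.
have cS : countable (Y |` sep @` (B `*` B)).
  apply: countable_setU; first exact: countable1.
  by apply: sub_countable (card_image_le _ _) _; exact: countableX.
have [T1 [cT1 ST1 T1I]] := countable_op_closure setI cS.
have cT1' : countable (set0 |` T1).
  by apply: countable_setU => //; exact: countable1.
have [T2 [cT2 ST2 T2U]] := countable_op_closure setU cT1'.
apply: sub_countable cT2; apply: subset_card_le => V kV.
have [VY cV cYV] := kV.
(* First use of compactness: x is separated from Y \ V by finitely many sets. *)
have T1V x : V x -> exists S, [/\ T1 S, clopen_in Y S, S x & S `<=` V].
  move=> Vx.
  have [|||U [S [TS kS Sx SU]] YU] := kY
    [set U | exists S, [/\ T1 S, clopen_in Y S, S x & S `&` U `<=` V]].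
  - exists Y; split; [by apply: ST1; left|exact: clopen_inT|exact: VY|].
    by rewrite setI0.
  - move=> U1 U2 [S1 [TS1 kS1 S1x SU1]] [S2 [TS2 kS2 S2x SU2]].
    exists (S1 `&` S2); split=> //; first exact: T1I.
      exact: clopen_inI.
    by move=> y [[S1y S2y] [U1y|U2y]]; [apply: SU1|apply: SU2].
  - move=> y Yy; have [Vy|nVy] := pselect (V y).
      exists V; split=> //; exists Y; split; [|exact: clopen_inT|exact: VY|by move=> z []].
      by apply: ST1; left.
    have [P1 [BP1 P1x] P1V] : filter_from [set U | B U /\ U x] id (~` (Y `\` V)).
      apply: bB; apply: open_nbhs_nbhs; split; first exact: closed_openC.
      by move=> [].
    have [P2 [BP2 P2y] P2V] : filter_from [set U | B U /\ U y] id (~` V).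
      apply: bB; apply: open_nbhs_nbhs; split => //; exact: closed_openC.
    have [kS] := sepP (P1, P2); case/(_ V kV) => /=.
    + by move=> z [/P1V Vz Yz]; apply: contrapT => nVz; apply: Vz.
    + by apply/seteqP; split=> // z [/P2V].
    + set S := sep _ in kS * => P1S P2S.
      exists (Y `\` S); split; last by split => // Sy; rewrite -[False]/(set0 y) -P2S.
        exists S; split=> //.
        * by apply: ST1; right; exists (P1, P2).
        * by apply: P1S; split => //; exact: VY.
        * by move=> z [Sz []].
      exact: clopen_inC.
  exists S; split => // y Sy; apply: SU; split => //; apply: YU.
  by case: kS => SY _ _; exact: SY.
(* Second use: finitely many of these neighbourhoods of points cover V. *)
have [|||U [S [TS US SV]] YU] :=
    kY [set U | exists S, [/\ T2 S, U `&` V `<=` S & S `<=` V]].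
- by exists set0; rewrite set0I; split => //; apply: ST2; left.
- move=> U1 U2 [S1 [TS1 US1 SV1]] [S2 [TS2 US2 SV2]].
  exists (S1 `|` S2); split; first exact: T2U.
    by rewrite setIUl; exact: setUSS.
  by rewrite subUset.
- move=> y Yy; have [Vy|nVy] := pselect (V y).
    have [S [TS kS Sy SV]] := T1V y Vy.
    exists S; split => //; by exists S; split => //; apply: ST2; right.
  exists (Y `\` V); split => //; last exact: clopen_inC.
  by exists set0; split => //; [apply: ST2; left|move=> z [[]]].
suff <- : S = V by [].
by apply/seteqP; split => // y Vy; apply: US; split => //; apply: YU; exact: VY.
Qed.

(** * Consequences of separable metrizability *)

Lemma compact_exhaustion : locally_compact [set: X] -> second_countable (T := X) ->
  exists O : nat -> set X, [/\ forall n, open (O n),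
    forall n, relatively_compact (O n), forall m n, (m <= n)%N -> O m `<=` O n &
    forall K, compact K -> exists n, K `<=` O n].
Proof.
move=> lcX [B cB [oB bB]].
(* The empty set is added because an enumeration needs a nonempty family. *)
pose B' := set0 |` [set U | B U /\ relatively_compact U].
have cB' : countable B'.
  apply: countable_setU; first exact: countable1.
  by apply: sub_countable cB; apply: subset_card_le => U [].
have [b bE] := countable_enum cB' (ex_intro _ set0 (or_introl erefl)).
have bP n : open (b n) /\ relatively_compact (b n).
  have : B' (b n) by rewrite -bE; exists n.
  move=> [->|[/oB]//]; split; [exact: open0|exact: relatively_compact0].
pose O n := \big[setU/set0]_(i < n) b i.
have OS n : O n.+1 = O n `|` b n by rewrite /O big_ord_recr.
have Omono m n : (m <= n)%N -> O m `<=` O n.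
  move=> /subnK <-; elim: (n - m)%N => // k IH.
  by rewrite addSn OS => x /IH; left.
exists O; split => //.
- elim=> [|n IH]; first by rewrite /O big_ord0; exact: open0.
  by rewrite OS; apply: openU => //; case: (bP n).
- elim=> [|n IH]; first by rewrite /O big_ord0; exact: relatively_compact0.
  by rewrite OS; apply: relatively_compactU => //; case: (bP n).
- move=> K cK.
  have [|||U [n UO] KU] := @compact_ideal _ K [set U | exists n, U `<=` O n] cK.
  + by exists 0%N.
  + move=> U V [m UO] [n VO]; exists (maxn m n); rewrite subUset; split.
      by apply: subset_trans UO _; apply: Omono; exact: leq_maxl.
    by apply: subset_trans VO _; apply: Omono; exact: leq_maxr.
  + move=> x _; have [V + [cV clV]] := lcX x I.
    rewrite /within /prop_near1 => VTx.
    have /bB[U [BU Ux] UV] : nbhs x V.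
      exact: (filterS (fun y (h : [set: X] y -> V y) => h I) VTx).
    have : B' U.
      right; split => //; rewrite /relatively_compact.
      apply: (subclosed_compact _ cV); first exact: closed_closure.
      by rewrite (closure_id V).1 //; exact: closureS.
    rewrite -bE => -[i _ biU]; exists U.
      by exists i.+1; rewrite OS biU; right.
    by apply: open_nbhs_nbhs; split => //; exact: oB.
  + by exists n; exact: subset_trans UO.
Qed.

Lemma separable_metrizable_second_countable (R : realType) :
  separable X -> metrizable R X -> second_countable (T := X).
Proof.
move=> [D cD dD] [M [f [cf [g [cg fK gK]]]]].
pose b (dn : X * nat) := f @^-1` (ball (f dn.1) (dn.2.+1%:R^-1 : R)%R)°.
exists (b @` (D `*` setT)).
  by apply: sub_countable (card_image_le _ _) _; exact: countableX.
split=> [_ [dn _ <-]|x U Ux].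
  apply: open_comp; last exact: open_interior.
  by move=> ? _; exact: cf.
have /nbhs_ballP[e /= e0 eU] : nbhs (f x) (g @^-1` U).
  by apply: cg; rewrite fK.
have [n ne] := @ltr_add_invr R 0%R (e / 2)%R (divr_gt0 e0 (ltr0Sn _ 1)).
rewrite add0r in ne.
have r0 : (0 < n.+1%:R^-1 / 2 :> R)%R by rewrite divr_gt0 ?invr_gt0 ?ltr0Sn.
have [d [dx Dd]] : (f @^-1` (ball (f x) (n.+1%:R^-1 / 2 : R)%R)°) `&` D !=set0.
  apply: dD; last first.
    by apply: open_comp; [move=> ? _; exact: cf|exact: open_interior].
  by exists x; exact: (nbhs_singleton (nbhs_interior (nbhsx_ballx _ _ r0))).
have {}dx := interior_subset dx.
exists (b (d, n)); first split.
- by exists (d, n).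
(* A ball around f x of half the radius fits in the ball around f d. *)
- apply: filterS (nbhsx_ballx (f x) _ r0) => z xz.
  rewrite /= [X in ball _ X](splitr (n.+1%:R^-1 : R)%R).
  by apply: ball_triangle xz; exact/ball_sym.
- move=> y /= /interior_subset fy; rewrite -[y]fK; apply: eU.
  apply: (@le_ball _ _ _ (n.+1%:R^-1 / 2 + n.+1%:R^-1)%R).
    rewrite [e]splitr lerD //; last exact: ltW.
    apply/ltW/(le_lt_trans _ ne); rewrite ler_pdivrMr // ler_peMr ?ler1n //.
    by rewrite invr_ge0.
  exact: ball_triangle fy.
Qed.

End Clopen_compactness.

(** * Topology of the Smirnov compactification *)

Section Cluster_topology.
Variables (X : Type) (p : sproximity X).
Implicit Types (s t : smirnov p) (A B C : set X).

Lemma smirnov_setD s A B : set_val s A -> ~ set_val s B -> set_val s (A `\` B).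
Proof.
move=> sA nsB; have : set_val s ((A `\` B) `|` B).
  by apply: smirnovS sA => x Ax; have [Bx|nBx] := pselect (B x); [right|left].
by move=> /(cluster_setU (smirnovP s))[].
Qed.

Lemma smirnovT s : set_val s setT.
Proof.
apply: (cluster_max (smirnovP s)) => A sA.
apply: (prox_meet (prox_is_proximity p)); rewrite setTI.
exact: (cluster_neq0 (smirnovP s)).
Qed.

Lemma open_avoid C : open [set s : smirnov p | ~ set_val s C].
Proof.
have -> : [set s : smirnov p | ~ set_val s C] = ~` closure (points p C).
  by rewrite closure_points.
by apply: closed_openC; exact: closed_closure.
Qed.

Lemma nbhs_smirnovP s (G : set (smirnov p)) :
  nbhs s G <-> exists2 C, ~ set_val s C & forall t, ~ set_val t C -> G t.
Proof.
split=> [|[C nsC CG]].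
  rewrite nbhsE => -[U [oU Us] UG].
  have nU : ~ smirnov_prox [set s] (~` U) := oU s Us.
  apply: contrapT => nC; apply: nU; apply/smirnov_prox1 => C UC.
  apply: contrapT => nsC; apply: nC; exists C => // t ntC.
  by apply: UG; apply: contrapT => nUt; apply: ntC; exact: UC.
by apply: (filterS CG); apply: open_nbhs_nbhs; split=> //; exact: open_avoid.
Qed.

Lemma nbhs_sub_smirnovP (S : set (smirnov p)) (s : S) (G : set S) :
  nbhs s G <-> exists2 C, ~ set_val (set_val s) C &
    forall t : S, ~ set_val (set_val t) C -> G t.
Proof.
split=> [[_ [[W oW <-] /= Ws WG]]|[C nsC CG]].
  have /nbhs_smirnovP[C nsC CW] : nbhs (set_val s) W by exact: open_nbhs_nbhs.
  by exists C => // t /CW Wt; exact: WG.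
exists [set t : S | ~ set_val (set_val t) C]; split=> //.
by exists [set t : smirnov p | ~ set_val t C] => //; exact: open_avoid.
Qed.

End Cluster_topology.

(** The basic neighbourhoods of [nbhs_sub_smirnovP] are described by the members
of the clusters alone, whatever the proximity. *)
Lemma same_clusters_continuous (X : Type) (p q : sproximity X)
    (S : set (smirnov p)) (T : set (smirnov q)) (h : S -> T) :
  (forall s, set_val (set_val (h s)) = set_val (set_val s)) -> continuous h.
Proof.
move=> hE s G /nbhs_sub_smirnovP[C nC CG]; apply/nbhs_sub_smirnovP.
by exists C; rewrite -?hE // => t nt; apply: CG; rewrite hE.
Qed.

(** * The boundary and the Freudenthal remainder *)

Section Freudenthal_clusters.
Variables (X : topologicalType) (lcX : locally_compact [set: X])
  (hX : hausdorff_space X).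
Implicit Types (A B D F K : set X) (sigma : set (set X)).
Let deltaF := freudenthal lcX hX.
Let delta := freudenthal_discrete lcX hX.
Let BC := @relatively_compact X.

Lemma compact_closed_separated K F : compact K -> closed F -> K `&` F = set0 ->
  compactly_separated K F.
Proof.
move=> cK cF KF; have [N [cN clN NF KN]] := compact_shield lcX hX cK cF KF.
exists (N `&` ~` N°), N°, (~` N); split; split.
- by apply: compact_closedI => //; exact/open_closedC/open_interior.
- by apply/seteqP; split => // z [[_ nNz] /KN].
- by apply/seteqP; split => // z [[Nz _] Fz]; rewrite -NF.
- exact: open_interior.
- exact: closed_openC.
- by apply/seteqP; split => // z [/interior_subset].
- by rewrite setCI setCK setUC.
- by split=> // z Fz Nz; rewrite -[False]/(set0 z) -NF.
Qed.

(** It is enough to cut B: a compact neighbourhood N of D cut from B leaves a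
set far from D, so the part of A in D does not contribute to the nearness of A
and B \ N. *)
Lemma freudenthal_coarse_setD A B :
  (forall D, relatively_compact D -> freudenthal_prox A (B `\` D)) ->
  freudenthal_coarse A B.
Proof.
move=> AB D rD.
have [N [cN clN _ DN]] := compact_shield lcX hX rD (@closed0 X) (setI0 _).
have rN : relatively_compact (D `|` N).
  by apply: relatively_compactU => //; rewrite /relatively_compact -(closure_id N).1.
have sub A' B' : A `<=` A' -> B `\` (D `|` N) `<=` B' -> freudenthal_prox A' B'.
  move=> AA' BB'; have h := AB _ rN.
  apply: (@proxS _ deltaF _ _ _ BB'); apply/(prox_symE deltaF).
  by apply: (@proxS _ deltaF _ _ _ AA'); exact/(prox_symE deltaF).
have : deltaF ((B `\` D) `&` ~` N) ((A `\` D) `|` D).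
  apply/(prox_symE deltaF); apply: sub => x.
    by move=> Ax; have [Dx|nDx] := pselect (D x); [right|left].
  by move=> [Bx nDNx]; split; [split=> // Dx|move=> Nx]; apply: nDNx; [left|right].
move=> /(prox_setU (prox_is_proximity deltaF))[/(prox_symE deltaF) ABD|].
  by apply: (@proxS _ deltaF _ _ _ _ ABD) => x [].
move=> /(prox_symE deltaF) DB; exfalso; apply: DB; apply: compact_closed_separated => //.
  exact: closed_closure.
apply/seteqP; split=> // x [/DN Nx /(_ _ Nx)[y [[_ nNy] Ny]]].
exact: nNy.
Qed.

Lemma delta_sub_deltaF A B : delta A B -> deltaF A B.
Proof.
move=> [/(prox_meet (prox_is_proximity deltaF))//|/(_ set0)].
by rewrite !setD0; apply; exact: relatively_compact0.
Qed.

(** A C near every member A of the family for deltaF is also near every A \ D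
with D bounded, which is nearness for delta; this is what maximality of
clusters needs. *)
Lemma unbounded_cluster_iff sigma : (forall B, BC B -> ~ sigma B) ->
  is_cluster delta sigma <-> is_cluster deltaF sigma.
Proof.
move=> nB.
have sD (p : sproximity X) (sc : is_cluster p sigma) A D :
    sigma A -> BC D -> sigma (A `\` D).
  move=> sA bD; apply: (@smirnov_setD _ _ (SigSub (mem_set sc)) A D sA).
  exact: nB.
split=> sc.
  split.
  - exact: cluster_neq0 sc.
  - by move=> A B sA sB; apply: delta_sub_deltaF; exact: cluster_near sc _ _ sA sB.
  - move=> C nearC; apply: (cluster_max sc) => A sA; right.
    by apply: freudenthal_coarse_setD => D bD; apply: nearC; exact: (sD delta).
  - exact: cluster_setU sc.
split.
- exact: cluster_neq0 sc.
- move=> A B sA sB; right=> D bD.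
  by apply: (cluster_near sc); exact: (sD deltaF).
- move=> C nearC; apply: (cluster_max sc) => A sA.
  by apply: delta_sub_deltaF; exact: nearC.
- exact: cluster_setU sc.
Qed.

(** A cluster without points misses a neighbourhood of each point, and a compact
set is covered by finitely many of them; as the sets that a cluster misses are
closed under union, it misses every bounded set. *)
Lemma remainder_unbounded (s : smirnov deltaF) :
  remainder deltaF s <-> forall B, BC B -> ~ set_val s B.
Proof.
have sc := smirnovP s; split=> [ns B bB sB|nB [x _ sx]]; last first.
  apply: (nB _ _ sx); rewrite /BC /relatively_compact -(closure_id _).1.
    exact: compact_set1.
  by apply: compact_closed => //; exact: compact_set1.
have [|||U nsU BU] := @compact_ideal _ (closure B) [set U | ~ set_val s U] bB.
- by move=> /(cluster_neq0 sc)[].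
- by move=> U V nU nV /(cluster_setU sc)[].
- move=> x _; have nsx : ~ set_val s [set x] by move=> sx; apply: ns; exists x.
  have [A sA nAx] := smirnov_notin nsx.
  have [E [nAE nEx]] := prox_split (prox_is_proximity deltaF) nAx.
  (* E is missed by s, being far from A, and it is a neighbourhood of x. *)
  exists E; first by move=> sE; apply: nAE; exact: cluster_near sc _ _ sA sE.
  have nclE : ~ closure (~` E) x.
    move=> clE; apply: nEx => /= -[K [U1 [U2 [_ [_ _ U12 _ [EU xU]]]]]].
    by rewrite -[False]/(set0 x) -U12; split; [exact: EU|exact/xU/subset_closure].
  have : nbhs x (~` closure (~` E)).
    by apply: open_nbhs_nbhs; split=> //; apply: closed_openC; exact: closed_closure.
  apply: filterS => y ncly; apply: contrapT => nEy; apply: ncly.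
  exact: subset_closure.
- by apply: nsU; apply: smirnovS sB; apply: subset_trans BU; exact: subset_closure.
Qed.

Lemma boundary_homeomorphic_remainder :
  exists h : boundary delta BC -> remainder deltaF, homeomorphism h /\
     forall A : set X,
       [set set_val (h s) | s in [set s | trace delta BC A (set_val s)]] =
       closure (points deltaF A) `&` remainder deltaF.
Proof.
have nB (s : boundary delta BC) B : BC B -> ~ set_val (set_val s) B.
  by have := set_valP s; apply.
have hc (s : boundary delta BC) : is_cluster deltaF (set_val (set_val s)).
  by apply/(unbounded_cluster_iff (nB s)); exact: smirnovP.
have hr (s : boundary delta BC) :
    remainder deltaF (SigSub (mem_set (hc s)) : smirnov deltaF).
  by apply/remainder_unbounded; exact: nB.
have nB' (s : remainder deltaF) B : BC B -> ~ set_val (set_val s) B.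
  by move: B; apply/remainder_unbounded; exact: set_valP.
have gc (s : remainder deltaF) : is_cluster delta (set_val (set_val s)).
  by apply/(unbounded_cluster_iff (nB' s)); exact: smirnovP.
have gr (s : remainder deltaF) :
    boundary delta BC (SigSub (mem_set (gc s)) : smirnov delta).
  exact: nB'.
pose h (s : boundary delta BC) : remainder deltaF := SigSub (mem_set (hr s)).
pose g (s : remainder deltaF) : boundary delta BC := SigSub (mem_set (gr s)).
have gK : cancel g h by move=> s; apply/val_inj/val_inj.
exists h; split.
  split; first exact: same_clusters_continuous.
  exists g; split=> //; first exact: same_clusters_continuous.
  by move=> s; apply/val_inj/val_inj.
move=> A; apply/seteqP; split=> [_ [s [+ _] <-]|s [+ rs]]; rewrite !closure_points.
  by move=> sA; split=> //; exact: hr.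
move=> sA; exists (g (SigSub (mem_set rs))); last by rewrite gK.
by split; [rewrite closure_points|exact: gr].
Qed.

End Freudenthal_clusters.

(** * Traces of closed sets of ends *)

Section Traces.
Variables (X : topologicalType) (lcX : locally_compact [set: X])
  (hX : hausdorff_space X).
Implicit Types (A B D F K V W : set X).
Let delta := freudenthal_discrete lcX hX.
Let BC := @relatively_compact X.
Implicit Type s : smirnov delta.

Lemma relatively_compactS A B : A `<=` B -> BC B -> BC A.
Proof.
by rewrite /BC /relatively_compact -!precompactE; exact: precompact_subset.
Qed.

Lemma finite_relatively_compact A : finite_set A -> BC A.
Proof.
move=> /finite_compact cA; rewrite /BC /relatively_compact -(closure_id A).1 //.
exact: compact_closed.
Qed.

(** The compact set closure O separates V from its complement in X \ O, once
both are cut along it. *)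
Lemma clopen_in_far (O V : set X) : open O -> BC O -> clopen_in (~` O) V ->
  ~ delta V (~` O `\` V).
Proof.
move=> oO rO [VO cV cW] [[x [Vx []//]]|].
move=> /(freudenthal_coarse_noclosure lcX hX)/(_ (closure O)); apply.
  by rewrite /relatively_compact -(closure_id _).1 //; exact: closed_closure.
pose K := closure O; have cK : closed K by exact: closed_closure.
have OK x : ~ K x -> ~ O x by move=> nK Ox; apply: nK; exact: subset_closure.
have U1E : V `\` K = ~` (K `|` (~` O `\` V)).
  apply/seteqP; split=> x; first by move=> [Vx nKx] [|[]].
  move=> nx; have nKx : ~ K x by move=> Kx; apply: nx; left.
  split=> //; apply: contrapT => nVx; apply: nx; right; split=> //; exact: OK.
have U2E : (~` O `\` V) `\` K = ~` (K `|` V).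
  apply/seteqP; split=> x; first by move=> [[_ nVx] nKx] [].
  move=> nx; have nKx : ~ K x by move=> Kx; apply: nx; left.
  by split=> //; split; [exact: OK|move=> Vx; apply: nx; right].
exists K, (V `\` K), ((~` O `\` V) `\` K); split; split=> //.
- by apply/seteqP; split=> // x [Kx []].
- by apply/seteqP; split=> // x [Kx []].
- by rewrite U1E; apply: closed_openC; exact: closedU.
- by rewrite U2E; apply: closed_openC; exact: closedU.
- by apply/seteqP; split=> // x [[Vx _] [[]]].
- apply/seteqP; split=> x; last by move=> [] [].
  by move=> nKx; have [Vx|nVx] := pselect (V x); [left|right; split=> //; split=> //; exact: OK].
- by split.
Qed.

(** Members of a cluster do not meet in a member in general; a relatively clopen
member can be intersected with because its complement is not a member. *)
Lemma clopen_in_meet (O V A : set X) s : open O -> BC O -> boundary delta BC s ->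
  clopen_in (~` O) V -> set_val s V -> set_val s A -> set_val s (A `&` V).
Proof.
move=> oO rO bs kV sV sA; rewrite -[V]setCK -setDE; apply: smirnov_setD => // snV.
have : set_val s (O `|` (~` O `\` V)).
  apply: smirnovS snV => x nVx.
  by have [Ox|nOx] := pselect (O x); [left|right].
move=> /(cluster_setU (smirnovP s))[|sW]; first exact: bs.
by apply: (clopen_in_far oO rO kV); exact: cluster_near (smirnovP s) _ _ sV sW.
Qed.

Section Exhaustion.
Variable O : nat -> set X.
Hypotheses (oO : forall n, open (O n)) (rO : forall n, BC (O n))
  (Omono : forall m n, (m <= n)%N -> O m `<=` O n)
  (Oexh : forall K, compact K -> exists n, K `<=` O n).

Definition end_clopen V := exists n, clopen_in (~` O n) V.

(** Take n such that O_n contains both the bounded set that is cut and the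
compact set K of the separation; then both sides of X \ K are clopen in
X \ O_n. *)
Lemma far_clopen_in A B : ~ delta A B -> exists n V,
  [/\ clopen_in (~` O n) V, A `<=` O n `|` V & B `<=` O n `|` (~` O n `\` V)].
Proof.
move=> /not_orP[_]; rewrite (freudenthal_coarse_noclosure lcX hX).
move=> /existsNP[D /not_implyP[rD /contrapT]].
move=> [K [U1 [U2 [[cK _ _] [o1 o2 U12 KU [AU BU]]]]]].
have [n KDO] := Oexh (compactU cK rD); exists n, (U1 `\` O n).
have KO x : ~ O n x -> (U1 `|` U2) x.
  by move=> nOx; rewrite -KU => Kx; apply: nOx; apply: KDO; left.
have DO x : ~ O n x -> ~ D x.
  by move=> nOx Dx; apply: nOx; apply: KDO; right; exact: subset_closure.
have U12F x : U1 x -> U2 x -> False.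
  by move=> U1x U2x; rewrite -[False]/(set0 x) -U12.
split.
- split; first by move=> x [].
    have -> : U1 `\` O n = ~` (U2 `|` O n).
      apply/seteqP; split=> x; first by move=> [U1x nOx] [/(U12F _ U1x)|].
      move=> nx; have nOx : ~ O n x by move=> Ox; apply: nx; right.
      by split=> //; have [//|U2x] := KO x nOx; case: nx; left.
    by apply: open_closedC; exact: openU.
  have -> : ~` O n `\` (U1 `\` O n) = ~` (U1 `|` O n).
    apply/seteqP; split=> x; first by move=> [nOx nU1] [U1x|//]; exact: nU1.
    by move=> nx; split; [move=> Ox; apply: nx; right|move=> [U1x _]; apply: nx; left].
  by apply: open_closedC; exact: openU.
- move=> x Ax; have [Ox|nOx] := pselect (O n x); first by left.
  by right; split=> //; apply: AU; split=> //; exact: DO.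
- move=> x Bx; have [Ox|nOx] := pselect (O n x); first by left.
  right; split=> // -[U1x _]; apply: U12F U1x _.
  by apply: BU; split=> //; exact: DO.
Qed.

Lemma boundary_absorb s n A V : boundary delta BC s -> A `<=` O n `|` V ->
  set_val s A -> set_val s V.
Proof.
move=> bs AV sA; have [|//] := cluster_setU (smirnovP s) (smirnovS AV sA).
by move=> sO; case: (bs _ (@rO n) sO).
Qed.

Lemma countable_end_clopen_traceable : countable end_clopen ->
  completely_traceable delta BC.
Proof.
move=> cV C clC [c0 Cc0].
have bP (t : boundary delta BC) : boundary delta BC (set_val t) := set_valP t.
have [e eE] : exists e : nat -> set X, range e =
    [set V | end_clopen V /\ exists2 t, C t & set_val (set_val t) V].
  apply: countable_enum.
    by apply: sub_countable cV; apply: subset_card_le => V [].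
  exists (~` O 0); split.
    by exists 0%N; apply: clopen_inT; exact: open_closedC.
  exists c0 => //; rewrite -setTD; apply: smirnov_setD; first exact: smirnovT.
  exact: bP.
have [w wE] : exists w : nat -> set X, range w =
    [set V | end_clopen V /\ forall t, C t -> set_val (set_val t) V].
  apply: countable_enum.
    by apply: sub_countable cV; apply: subset_card_le => V [].
  exists (~` O 0); split.
    by exists 0%N; apply: clopen_inT; exact: open_closedC.
  move=> t _; rewrite -setTD; apply: smirnov_setD; first exact: smirnovT.
  exact: bP.
have eP i : exists2 t, C t & set_val (set_val t) (e i).
  by have : range e (e i) by []; rewrite eE => -[].
have wP j : end_clopen (w j) /\ forall t, C t -> set_val (set_val t) (w j).
  by have : (range w) (w j) by []; rewrite wE.
pose G k := \big[setI/setT]_(j < k) w j.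
have Gw j k : (j < k)%N -> G k `<=` w j.
  by rewrite /G -bigcap_mkord => jk x; apply.
have /choice[x xP] : forall ik : nat * nat, exists x,
    (e ik.1 `&` G ik.2 `\` O ik.2) x.
  move=> [i k]; have [t Ct te] := eP i.
  have eG : set_val (set_val t) (e i `&` G k).
    elim: k => [|k IH]; first by rewrite /G big_ord0 setIT.
    rewrite /G big_ord_recr /= setIA; have [[n kw] wt] := wP k.
    by apply: clopen_in_meet kw _ _ => //; exact: wt.
  apply: (cluster_neq0 (smirnovP (set_val t))); apply: smirnov_setD => //.
  exact: bP.
pose A := x @` [set ik | (ik.1 <= ik.2)%N].
(* Points outside w j have both indices at most j. *)
have Aw j : BC (A `\` w j).
  pose Fin := x @` (`I_j.+1 `*` `I_j.+1).
  apply: (@relatively_compactS _ Fin).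
    move=> _ [[[i k] /= ik <-] nw]; exists (i, k) => //=.
    have kj : (k < j.+1)%N.
      rewrite ltnS leqNgt; apply/negP => jk; apply: nw; apply: (Gw j k jk).
      by have [[]] := xP (i, k).
    by split=> //=; exact: leq_ltn_trans ik kj.
  by apply: finite_relatively_compact; apply: finite_image; exact: finite_setX.
(* The x (i, k) with k >= i leave every O n. *)
have Ae i : ~ BC (A `&` e i).
  move=> bA; have [n An] := Oexh bA; pose k := maxn i n.
  have [[ex _] nOx] := xP (i, k); apply: nOx.
  apply: (Omono (leq_maxr i n)); apply: An; apply: subset_closure; split=> //.
  by exists (i, k) => //=; exact: leq_maxl.
exists A; split.
  by move=> bA; apply: (Ae 0%N); apply: relatively_compactS bA; exact: subIsetl.
rewrite /trace closure_points; apply/seteqP; split=> [s [sA bs]|_ [t Ct <-]].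
  pose t : boundary delta BC := SigSub (mem_set bs).
  exists t => //; apply: contrapT => nCt.
  have /nbhs_sub_smirnovP[B nsB BC'] : nbhs t (~` C).
    by apply: open_nbhs_nbhs; split=> //; exact: closed_openC.
  have CB u : C u -> set_val (set_val u) B.
    by move=> Cu; apply: contrapT => /BC'; apply.
  have [S sS /far_clopen_in[n [V [kV SV BW]]]] := smirnov_notin nsB.
  (* A relatively clopen set that belongs to all clusters of C but not to s;
     as one of the w j, it contains A up to a bounded set. *)
  have [j _ wj] : (range w) (~` O n `\` V).
    rewrite wE; split; first by exists n; exact: clopen_inC.
    by move=> u Cu; apply: (boundary_absorb (bP u) BW); exact: CB.
  have sw : set_val s (~` O n `\` V).
    rewrite -wj; apply: smirnovS (smirnov_setD sA (bs _ (Aw j))) => y [Ay nAw].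
    by apply: contrapT => nwy; apply: nAw.
  apply: (clopen_in_far (oO n) (@rO n) kV).
  by apply: (cluster_near (smirnovP s)) sw; exact: boundary_absorb bs SV sS.
split; last exact: bP.
apply: contrapT => ntA; have [S tS /far_clopen_in[n [V [kV SV AW]]]] := smirnov_notin ntA.
(* As one of the e i, V has an unbounded intersection with A. *)
have [i _ ei] : (range e) V.
  by rewrite eE; split; [exists n|exists t => //; exact: boundary_absorb (bP t) SV tS].
apply: (Ae i); apply: relatively_compactS (@rO n) => y [Ay]; rewrite ei => Vy.
by have [|[_ /(_ Vy)]] := AW y Ay.
Qed.

End Exhaustion.
End Traces.

Theorem corollary5p4 (R : realType) (X : topologicalType)
  (lcX : locally_compact [set: X]) (sX : separable X) (mX : metrizable R X)
  (cQ : compact [set: quasi_components X]) :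
  let deltaF := freudenthal lcX (metrizable_hausdorff mX) in
  let delta := freudenthal_discrete lcX (metrizable_hausdorff mX) in
  let BC := @relatively_compact X in
  (exists h : boundary delta BC -> remainder deltaF, homeomorphism h /\
     forall A : set X,
       [set set_val (h s) | s in [set s | trace delta BC A (set_val s)]] =
       closure (points deltaF A) `&` remainder deltaF) /\
  completely_traceable delta BC.
Proof.
move=> deltaF delta BC; split; first exact: boundary_homeomorphic_remainder.
have hX := metrizable_hausdorff mX.
have scX := separable_metrizable_second_countable sX mX.
have [O [oO rO Omono Oexh]] := compact_exhaustion lcX scX.
apply: (countable_end_clopen_traceable oO rO Omono Oexh).
have -> : end_clopen O = \bigcup_n clopen_in (~` O n).
  by apply/seteqP; split=> V [n]; exists n.
apply: bigcup_countable => // n _; apply: countable_clopen_in => //.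
  exact: open_closedC.
by apply: clopen_compactC => //; exact: quasi_components_clopen_compact.
Qed.
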